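(* Let $L$ be a Leibniz algebra over a field $\mathbb{K}$. The centralizer $C_L(x)$ is a left ideal of $L$ for every $x\in L$ if and only if $L$ is a left CL-algebra. Likewise, $C_L(x)$ is a right ideal of $L$ for every $x\in L$ if and only if $L$ is a right CL-algebra.
   Context: A Leibniz algebra over a field $\mathbb{K}$ is a $\mathbb{K}$-vector space $L$ with a $\mathbb{K}$-bilinear bracket $[\cdot,\cdot]:L\times L\to L$ satisfying $[x,[y,z]]=[[x,y],z]-[[x,z],y]$ for all $x,y,z\in L$. The centralizer of $x\in L$ is $C_L(x)=\{y\in L\mid [x,y]=0=[y,x]\}$. A linear subspace $P\subseteq L$ is a left ideal if $[a,y]\in P$ for all $a\in L$, $y\in P$, and a right ideal if $[y,a]\in P$ for all $a\in L$, $y\in P$. $L$ is a left CL-algebra if $[[x,a],y]=0$ and $[[a,x],y]=0$ for all $a,x\in L$ and all $y\in C_L(x)$. $L$ is a right CL-algebra if $[[x,a],y]=0$ and $[y,[a,x]]=0$ for all $a,x\in L$ and all $y\in C_L(x)$. *)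

(* Defs.v *)
From mathcomp Require Import all_boot all_algebra.
Set Implicit Arguments.
Unset Strict Implicit.
Unset Printing Implicit Defensive.
Import GRing.Theory.
Local Open Scope ring_scope.

(* [L] is an arbitrary [lmodType K], so no finite-dimensionality is assumed. *)

Section Leibniz.
Variables (K : fieldType) (L : lmodType K).

(* The right Leibniz identity: right multiplications are derivations. *)
Definition leibniz_identity (br : L -> L -> L) : Prop :=
  forall x y z : L, br x (br y z) = br (br x y) z - br (br x z) y.

Record leibniz_bracket := LeibnizBracket {
  bracket_bilinear :> {bilinear L -> L -> L};
  bracket_leibniz : leibniz_identity bracket_bilinear }.

Variable br : leibniz_bracket.

Definition centralizer (x : L) : {pred L} :=
  [pred y | (br x y == 0) && (br y x == 0)].

Definition left_ideal (P : {pred L}) : Prop :=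
  GRing.submod_closed P /\ forall a y : L, y \in P -> br a y \in P.

Definition right_ideal (P : {pred L}) : Prop :=
  GRing.submod_closed P /\ forall a y : L, y \in P -> br y a \in P.

Definition left_CL_algebra : Prop :=
  forall a x y : L, y \in centralizer x ->
    br (br x a) y = 0 /\ br (br a x) y = 0.

(* Unlike the left case, the second condition has [y] on the left. *)
Definition right_CL_algebra : Prop :=
  forall a x y : L, y \in centralizer x ->
    br (br x a) y = 0 /\ br y (br a x) = 0.

End Leibniz.

(* Main.v *)
Require Import Defs.
From mathcomp Require Import all_boot all_algebra.

(* For y in C_L(x) the Leibniz identity turns each condition "[a,y] (resp.
   [y,a]) lies in C_L(x)" into the corresponding CL identities at (a, x, y), by
     [x,[a,y]] = [[x,a],y],       [[a,y],x] = [[a,x],y],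
     [x,[y,a]] = - [[x,a],y],     [[y,a],x] = [y,[a,x]].
   So both equivalences hold pointwise. *)

Import GRing.Theory.
Local Open Scope ring_scope.

Lemma centralizerP (K : fieldType) (L : lmodType K) (br : leibniz_bracket L)
    (x y : L) :
  reflect (br x y = 0 /\ br y x = 0) (y \in centralizer br x).
Proof. by apply: (iffP andP) => -[/eqP xy0 /eqP yx0]; split. Qed.

(** The centralizer is the common kernel of the linear maps [br x] and [br ^~ x]. *)
Lemma centralizer_submod (K : fieldType) (L : lmodType K)
    (br : leibniz_bracket L) (x : L) :
  GRing.submod_closed (centralizer br x).
Proof.
split=> [|k u v /centralizerP[xu ux] /centralizerP[xv vx]].
  by apply/centralizerP; rewrite linear0r linear0l.
by apply/centralizerP; rewrite linearPr linearPl /= xu ux xv vx scaler0 addr0.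
Qed.

Lemma centralizer_mull (K : fieldType) (L : lmodType K)
    (br : leibniz_bracket L) (a x y : L) : y \in centralizer br x ->
  br a y \in centralizer br x <-> br (br x a) y = 0 /\ br (br a x) y = 0.
Proof.
case/centralizerP=> xy yx.
have -> : br (br x a) y = br x (br a y).
  by rewrite bracket_leibniz xy linear0l subr0.
(* By Leibniz the two sides differ by [br a (br x y)], which is [br a 0]. *)
have -> : br (br a x) y = br (br a y) x.
  by apply/eqP; rewrite -subr_eq0 -bracket_leibniz xy linear0r.
by split=> [/centralizerP|H] //; apply/centralizerP.
Qed.

Lemma centralizer_mulr (K : fieldType) (L : lmodType K)
    (br : leibniz_bracket L) (a x y : L) : y \in centralizer br x ->
  br y a \in centralizer br x <-> br (br x a) y = 0 /\ br y (br a x) = 0.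
Proof.
case/centralizerP=> xy yx.
(* In the expansion of [br x (br y a)] the vanishing term is the positive one, hence the sign. *)
have -> : br (br x a) y = - br x (br y a).
  by rewrite bracket_leibniz xy linear0l sub0r opprK.
(* Here [br y x = 0] enters: it kills the subtracted term [br (br y x) a]. *)
have -> : br y (br a x) = br (br y a) x.
  by rewrite bracket_leibniz yx linear0l subr0.
split=> [/centralizerP[-> ->]|[/eqP]]; first by rewrite oppr0.
by rewrite oppr_eq0 => /eqP xya yax; apply/centralizerP.
Qed.

Theorem theorem3p10 (K : fieldType) (L : lmodType K) (br : leibniz_bracket L) :
  ((forall x : L, left_ideal br (centralizer br x)) <-> left_CL_algebra br) /\
  ((forall x : L, right_ideal br (centralizer br x)) <-> right_CL_algebra br).
Proof.
split; split=> [idC a x y Cy|CL x].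
- by apply/(centralizer_mull _ _ _ _ _ _ Cy); apply: (idC x).2.
(* The subspace half is unconditional; the CL identities supply absorption. *)
- split=> [|a y Cy]; first exact: centralizer_submod.
  by apply/(centralizer_mull _ _ _ _ _ _ Cy); apply: CL.
- by apply/(centralizer_mulr _ _ _ _ _ _ Cy); apply: (idC x).2.
- split=> [|a y Cy]; first exact: centralizer_submod.
  by apply/(centralizer_mulr _ _ _ _ _ _ Cy); apply: CL.
Qed.
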